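(* Let $n\ge2$, $\gamma\in\mathbb{R}$ and $n<p<+\infty$. There exists a constant $C=C(n,\gamma,p)>0$ such that, for every $u\in C^\infty_c(\mathbb{R}^n_+)$ and every $x,y\in\mathbb{R}^n_+$, \[ |u(x)-u(y)|\le C\,\Theta^0_{1-\frac np,\,1-\frac{n+\gamma}{p}}(x,y)\Big(\int_{\mathbb{R}^n_+}|Du(z)|^pz_n^\gamma\,dz\Big)^{1/p}. \] Explicitly: if $\gamma>p-n$ the factor is $\frac{|x-y|^{1-\frac np}}{\min(x_n,y_n)^{\frac{n+\gamma}{p}-1}\max(x_n,y_n,|x-y|)^{1-\frac np}}$, and if $\gamma\le p-n$ it is $\frac{\max(x_n,y_n)^{1-\frac{n+\gamma}{p}}|x-y|^{1-\frac np}}{\max(x_n,y_n,|x-y|)^{1-\frac np}}$.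
   Context: $\mathbb{R}^n_+=\mathbb{R}^{n-1}\times(0,+\infty)$, points written $x=(x',x_n)$; $C^\infty_c(\mathbb{R}^n_+)$ are smooth functions with compact support contained in the open half-space. For $\beta,\kappa\in\mathbb{R}$: $\Theta^0_{\beta,\kappa}(x,y)=\frac{|x-y|^\beta}{\min(x_n,y_n)^{-\kappa}\max(x_n,y_n,|x-y|)^\beta}$ if $\kappa<0$, and $\Theta^0_{\beta,\kappa}(x,y)=\frac{\max(x_n,y_n)^\kappa|x-y|^\beta}{\max(x_n,y_n,|x-y|)^\beta}$ if $\kappa\ge0$. *)

(* Defs.v *)
From HB Require Import structures.
From mathcomp Require Import all_boot all_order all_algebra.
From mathcomp Require Import all_classical all_reals all_analysis.
Set Implicit Arguments. Unset Strict Implicit. Unset Printing Implicit Defensive.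
Import Order.TTheory GRing.Theory Num.Theory.
Import numFieldNormedType.Exports.
Local Open Scope classical_set_scope.
Local Open Scope ring_scope.

Section Defs.
Variable R : realType.

(* Points of R^n are row vectors 'rV[R]_n; the dimension used below is n.+2
   (i.e. any dimension >= 2) and the last coordinate is index ord_max. *)

Definition enorm (n : nat) (v : 'rV[R]_n) : R :=
  Num.sqrt (\sum_(i < n) (v 0 i) ^+ 2).

Definition lastc (n : nat) (x : 'rV[R]_n.+1) : R := x 0 ord_max.

Definition halfspace (n : nat) : set 'rV[R]_n.+1 := [set x | 0 < lastc x].

Fixpoint iterD (n : nat) (vs : seq 'rV[R]_n) (f : 'rV[R]_n -> R) : 'rV[R]_n -> R :=
  if vs is v :: vs' then 'D_v (iterD vs' f) else f.

Definition smooth (n : nat) (f : 'rV[R]_n -> R) : Prop :=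
  forall (vs : seq 'rV[R]_n) (x : 'rV[R]_n), differentiable (iterD vs f) x.

Definition Cc_infty_halfspace (n : nat) (u : 'rV[R]_n.+1 -> R) : Prop :=
  smooth u /\
  exists K : set 'rV[R]_n.+1,
    compact K /\ K `<=` @halfspace n /\ (forall x, ~ K x -> u x = 0).

Definition partial (n : nat) (i : 'I_n) (u : 'rV[R]_n -> R) (z : 'rV[R]_n) : R :=
  'D_(delta_mx 0 i) u z.

Definition grad_norm (n : nat) (u : 'rV[R]_n -> R) (z : 'rV[R]_n) : R :=
  Num.sqrt (\sum_(i < n) (partial i u z) ^+ 2).

(* Lebesgue integral over R^k of a nonnegative function, computed as an
   iterated one-dimensional Lebesgue integral (Tonelli) *)
Fixpoint iint (k : nat) (f : seq R -> \bar R) : \bar R :=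
  if k is k'.+1 then
    (\int[@lebesgue_measure R]_(t in [set: R]) iint k' (fun s => f (t :: s)))%E
  else f [::].

Definition row_of_seq (n : nat) (s : seq R) : 'rV[R]_n := \row_(i < n) nth 0 s i.

Definition int_halfspace (m : nat) (g : 'rV[R]_m.+1 -> \bar R) : \bar R :=
  iint m.+1 (fun s => let z := row_of_seq m.+1 s in
                      if 0 < lastc z then g z else 0%E).

Definition Theta0 (m : nat) (beta kappa : R) (x y : 'rV[R]_m.+1) : R :=
  let d := enorm (x - y) in
  let M := Num.max (Num.max (lastc x) (lastc y)) d in
  if kappa < 0 then
    d `^ beta / (Num.min (lastc x) (lastc y) `^ (- kappa) * M `^ beta)
  else
    Num.max (lastc x) (lastc y) `^ kappa * d `^ beta / M `^ beta.

End Defs.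

(* Main.v *)
(* Fix x, a height h and a cube B at height h. Joining x to the points of B by
   segments and averaging bounds the mean of |u x - u z| over z in B by an
   integral of |Du| over the cone spanned by x and B. The elementary inequality
   g <= A + A^(1-p) g^p, with A chosen so that A^(1-p) is the product of the
   Jacobian of the cone parametrisation and the weight, replaces Hoelder's
   inequality and leaves only the integral of a power of the cone parameter,
   which converges because p > n.
   - If |x - y| <= max(x_n, y_n) / 2, the cones from x and from y to a common
     cube live where the weight is comparable to max(x_n, y_n)^gamma.
   - Otherwise it suffices to bound |u x| by x_n^kappa, kappa = 1 - (n+gamma)/p.
     If kappa >= 0, take the cone from x down to the boundary, where u = 0; the
     weight is integrable up to the boundary because gamma <= p - n < p - 1.
     If kappa < 0, sum the local estimate along the points of height 2^k x_n
     above x until u vanishes: the errors form a geometric series. *)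
Require Import Defs.
From HB Require Import structures.
From mathcomp Require Import all_boot all_order all_algebra.
From mathcomp Require Import all_classical all_reals all_analysis.
From mathcomp Require Import measurable_realfun.
From mathcomp Require Import ring lra.
Import Order.TTheory GRing.Theory Num.Theory.
Import numFieldNormedType.Exports.
Local Open Scope classical_set_scope.
Local Open Scope ring_scope.

Set Implicit Arguments.
Unset Strict Implicit.
Unset Printing Implicit Defensive.

(** * Iterated integrals *)

Section IteratedIntegral.
Context {R : realType}.
Local Open Scope ereal_scope.
Notation mu := (@lebesgue_measure R).

(* Contrary to [ge0_le_integral], no measurability is required. *)
Lemma le_integral_ge0 d (T : measurableType d) (m : {measure set T -> \bar R})
    (f g : T -> \bar R) :
  (forall x, 0 <= f x) -> (forall x, f x <= g x) ->
  \int[m]_x f x <= \int[m]_x g x.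
Proof.
move=> f0 fg.
have g0 x : 0 <= g x by exact: le_trans (fg x).
rewrite !ge0_integralTE//; apply: ereal_sup_le => _ [h hf <-]/=.
by exists h => // x; exact: le_trans (fg x).
Qed.

Lemma iint_ge0 k (f : seq R -> \bar R) :
  (forall s, size s = k -> 0 <= f s) -> 0 <= iint k f.
Proof.
elim: k f => [|k IH] f f0 /=; first exact: f0.
by apply: integral_ge0 => t _; apply: IH => s sk; apply: f0; rewrite /= sk.
Qed.

Lemma le_iint k (f g : seq R -> \bar R) :
  (forall s, size s = k -> 0 <= f s) ->
  (forall s, size s = k -> f s <= g s) -> iint k f <= iint k g.
Proof.
elim: k f g => [|k IH] f g f0 fg /=; first exact: fg.
apply: le_integral_ge0 => t.
  by apply: iint_ge0 => s sk; apply: f0; rewrite /= sk.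
by apply: IH => s sk; [apply: f0|apply: fg]; rewrite /= sk.
Qed.

Lemma eq_iint k (f g : seq R -> \bar R) :
  (forall s, size s = k -> f s = g s) -> iint k f = iint k g.
Proof.
elim: k f g => [|k IH] f g fg /=; first exact: fg.
by apply: eq_integral => t _; apply: IH => s sk; apply: fg; rewrite /= sk.
Qed.

(** [iint] peels coordinates off at the head. Here the last one, the height, is split off, so that
    the half-space can be sliced horizontally. *)
Lemma iint_rcons k (f : seq R -> \bar R) :
  iint k.+1 f = iint k (fun s => \int[mu]_t f (rcons s t)).
Proof.
elim: k f => [//|k IH] f.
by apply: eq_integral => t _; exact: (IH (fun s => f (t :: s))).
Qed.

(* The parameter in T absorbs the coordinates already integrated out, which is
   what makes inductions on k possible. *)
Definition seq_measurable d (T : measurableType d) k (f : T -> seq R -> \bar R) :=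
  measurable_fun [set: T * k.-tuple R] (fun q => f q.1 q.2).

Lemma seq_measurable_cons d (T : measurableType d) k (f : T -> seq R -> \bar R) :
  seq_measurable k.+1 f ->
  seq_measurable k (fun (q : T * R) s => f q.1 (q.2 :: s)).
Proof.
move=> mf.
pose g (q : (T * R) * k.-tuple R) : T * k.+1.-tuple R :=
  (q.1.1, [the k.+1.-tuple R of q.1.2 :: q.2]).
suff mg : measurable_fun setT g by exact: measurableT_comp mf mg.
apply/measurable_fun_pairP; split.
  exact: (measurableT_comp measurable_fst measurable_fst).
apply: measurable_cons; last exact: measurable_snd.
exact: (measurableT_comp measurable_snd measurable_fst).
Qed.

Lemma seq_measurable_comp d d' (T : measurableType d) (T' : measurableType d') k
    (h : T' -> T) (f : T -> seq R -> \bar R) :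
  measurable_fun setT h ->
  seq_measurable k f -> seq_measurable k (fun x => f (h x)).
Proof.
move=> mh mf.
pose g (q : T' * k.-tuple R) : T * k.-tuple R := (h q.1, q.2).
suff mg : measurable_fun setT g by exact: measurableT_comp mf mg.
apply/measurable_fun_pairP; split; last exact: measurable_snd.
exact: (measurableT_comp mh measurable_fst).
Qed.

Lemma seq_measurable_section d (T : measurableType d) k (f : T -> seq R -> \bar R)
    (x : T) : seq_measurable k.+1 f ->
  seq_measurable k (fun (t : R) s => f x (t :: s)).
Proof.
move=> /seq_measurable_cons; apply: (@seq_measurable_comp _ _ _ _ _ (fun t : R => (x, t))).
exact: measurable_pair1.
Qed.

Lemma measurable_iint d (T : measurableType d) k (f : T -> seq R -> \bar R) :
  (forall x s, 0 <= f x s) -> seq_measurable k f ->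
  measurable_fun setT (fun x => iint k (f x)).
Proof.
elim: k d T f => [|k IH] d T f f0 mf /=.
  pose h (x : T) : T * 0.-tuple R := (x, [tuple]).
  suff mh : measurable_fun setT h by exact: measurableT_comp mf mh.
  apply/measurable_fun_pairP; split; first exact: measurable_id.
  exact: (measurable_cst ([tuple] : 0.-tuple R)).
have /IH := seq_measurable_cons mf.
move=> /(_ (fun q s => f0 _ _)) mg.
apply: (measurable_fun_fubini_tonelli_F (m2 := mu)
  (fun q : T * R => iint k (fun s => f q.1 (q.2 :: s))) mg).
by move=> q; exact: iint_ge0.
Qed.

(** Induction on [k]: two-dimensional Tonelli exchanges t with the first coordinate, the induction
    hypothesis with the remaining ones. *)
Lemma iint_tonelli k (f : R -> seq R -> \bar R) :
  (forall x s, 0 <= f x s) -> seq_measurable k f ->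
  \int[mu]_t iint k (f t) = iint k (fun s => \int[mu]_t f t s).
Proof.
elim: k f => [//|k IH] f f0 mf /=.
have mg := measurable_iint (fun q s => f0 _ _) (seq_measurable_cons mf).
rewrite (fubini_tonelli (m1 := mu) (m2 := mu)
  (fun q : R * R => iint k (fun s => f q.1 (q.2 :: s))) mg) //=; last first.
  by move=> q; exact: iint_ge0.
apply: eq_integral => h _; rewrite IH//.
have := seq_measurable_cons mf.
apply: (@seq_measurable_comp _ _ _ _ _ (fun t : R => (t, h))).
exact: measurable_pair2.
Qed.

Lemma ge0_iintZl d (T : measurableType d) k (c : R) (f : T -> seq R -> \bar R)
    (x : T) : (0 <= c)%R ->
  (forall x s, 0 <= f x s) -> seq_measurable k f ->
  iint k (fun s => c%:E * f x s) = c%:E * iint k (f x).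
Proof.
move=> c0; elim: k d T x f => [//|k IH] d T x f f0 mf /=.
have mh := seq_measurable_section x mf.
under eq_integral => t _ do rewrite (IH _ _ t _ (fun _ _ => f0 _ _) mh).
rewrite ge0_integralZl//; last by move=> t _; exact: iint_ge0.
exact: measurable_iint mh.
Qed.

Lemma ge0_iintD d (T : measurableType d) k (f g : T -> seq R -> \bar R)
    (x : T) :
  (forall x s, 0 <= f x s) -> seq_measurable k f ->
  (forall x s, 0 <= g x s) -> seq_measurable k g ->
  iint k (fun s => f x s + g x s) = iint k (f x) + iint k (g x).
Proof.
elim: k d T x f g => [//|k IH] d T x f g f0 mf g0 mg /=.
have mf' := seq_measurable_section x mf.
have mg' := seq_measurable_section x mg.
under eq_integral => t _
  do rewrite (IH _ _ t _ _ (fun _ _ => f0 _ _) mf' (fun _ _ => g0 _ _) mg').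
rewrite ge0_integralD//.
- by move=> t _; exact: iint_ge0.
- exact: measurable_iint mf'.
- by move=> t _; exact: iint_ge0.
- exact: measurable_iint mg'.
Qed.

End IteratedIntegral.

(** * Affine changes of variables *)

Section AffineChange.
Context {R : realType}.
Local Open Scope ereal_scope.
Notation mu := (@lebesgue_measure R).

Lemma measurable_affine (b c : R) : measurable_fun setT (fun y : R => b + c * y)%R.
Proof. by apply: measurable_funD => //; exact: measurable_funM. Qed.

(** The measure [nu], |c| times the push-forward of Lebesgue measure under [phi], agrees with
    Lebesgue measure on the intervals ]u, v], hence on all measurable sets. *)
Lemma ge0_integral_affine (b c : R) (f : R -> \bar R) : c != 0%R ->
  measurable_fun setT f -> (forall y, 0 <= f y) ->
  \int[mu]_y f (b + c * y)%R = (`|c|^-1)%:E * \int[mu]_y f y.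
Proof.
move=> c0 mf f0; pose phi (y : measurableTypeR R) : measurableTypeR R := (b + c * y)%R.
have mphi : measurable_fun setT phi by exact: measurable_affine.
have ac0 : (0 < `|c|)%R by rewrite normr_gt0.
pose nu : {measure set (measurableTypeR R) -> \bar R} :=
  mscale (NngNum (normr_ge0 c))
    (measure_function_pushforward__canonical__measure_function_Measure mu mphi).
have munu A : measurable A -> mu A = nu A.
  move=> mA; apply: (@lebesgue_measure_unique R nu _ A mA) => _ [[u v]] _ <-.
  change (nu _) with (`|c|%:E * mu (phi @^-1` `]u, v]%classic)).
  rewrite /mscale /pushforward/= lebesgue_measure_itv/= lte_fin.
  have [cp|cn|/eqP] := ltgtP 0%R c; last by rewrite eq_sym (negPf c0).
    rewrite (_ : phi @^-1` _ = `]((u - b) / c)%R, ((v - b) / c)%R]%classic); last first.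
      apply/seteqP; split=> y /=; rewrite !in_itv/= /phi.
        by rewrite ltr_pdivrMr// ler_pdivlMr// ltrBlDl lerBrDl (mulrC y).
      by rewrite ltr_pdivrMr// ler_pdivlMr// ltrBlDl lerBrDl (mulrC y).
    rewrite lebesgue_measure_itv/= lte_fin ltr_pM2r ?invr_gt0// ltrD2r.
    case: ifPn => uv; last by rewrite mule0.
    by rewrite -!EFinB -EFinM gtr0_norm//; congr EFin; field.
  (* For c < 0 the map reverses order, so the preimage is closed on the left and open on the
     right. *)
  rewrite (_ : phi @^-1` _ = `[((v - b) / c)%R, ((u - b) / c)%R[%classic); last first.
    apply/seteqP; split=> y /=; rewrite !in_itv/= /phi.
      by rewrite ler_ndivrMr// ltr_ndivlMr// ltrBlDl lerBrDl (mulrC y) andbC.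
    by rewrite ler_ndivrMr// ltr_ndivlMr// ltrBlDl lerBrDl (mulrC y) andbC.
  rewrite lebesgue_measure_itv/= lte_fin ltr_nM2r ?invr_lt0// ltrD2r.
  case: ifPn => uv; last by rewrite mule0.
  by rewrite -!EFinB -EFinM ltr0_norm//; congr EFin; field.
have -> : \int[mu]_y f y = \int[nu]_y f y.
  by apply: eq_measure_integral => A mA _; exact: munu.
rewrite ge0_integral_mscale//= ge0_integral_pushforward//.
by rewrite muleA -EFinM mulVf ?gt_eqF// mul1e.
Qed.

(** * Homotheties and cubes in the horizontal variables *)

Definition homothety (t : R) (xs s : seq R) : seq R :=
  [seq (z.1 + t * (z.2 - z.1))%R | z <- zip xs s].

Lemma size_homothety t xs s : size s = size xs -> size (homothety t xs s) = size xs.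
Proof. by move=> ss; rewrite size_map size1_zip// ss. Qed.

Lemma nth_homothety t xs s i : size s = size xs -> (i < size xs)%N ->
  nth 0%R (homothety t xs s) i = (nth 0 xs i + t * (nth 0 s i - nth 0 xs i))%R.
Proof.
move=> ss ix; rewrite (nth_map (0%R, 0%R)) ?size1_zip ?ss//.
by rewrite nth_zip.
Qed.

(** Each coordinate undergoes an affine change of ratio t and contributes a factor 1/t. *)
Lemma iint_homothety d (T : measurableType d) k (t : R) (xs : seq R)
    (f : T -> seq R -> \bar R) (x : T) :
  (0 < t)%R -> size xs = k -> (forall x s, 0 <= f x s) -> seq_measurable k f ->
  iint k (fun s => f x (homothety t xs s)) = (t ^- k)%:E * iint k (f x).
Proof.
move=> t0; elim: k xs d T f x => [|k IH] [|x0 xs]// d T f x.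
  by move=> _ f0 mf /=; rewrite expr0 invr1 mul1e.
move=> [sxs] f0 mf /=.
have mh := seq_measurable_section x mf.
pose H (y : R) := iint k (fun s => f x (y :: s)).
have mH : measurable_fun setT H := measurable_iint (fun _ _ => f0 _ _) mh.
have H0 y : 0 <= H y by exact: iint_ge0.
transitivity (\int[mu]_y ((t ^- k)%:E * H ((x0 - t * x0) + t * y)%R)).
  apply: eq_integral => y _; rewrite (_ : (_ - _ + _ = x0 + t * (y - x0))%R); last by ring.
  exact: (IH xs _ _ (fun (y : R) s => f x (y :: s)) _ sxs (fun _ _ => f0 _ _) mh).
rewrite ge0_integralZl//.
- rewrite (ge0_integral_affine _ _ mH)// ?gt_eqF// muleA -EFinM gtr0_norm//.
  by rewrite exprSr invfM mulrC.
- exact: (measurableT_comp mH (measurable_affine _ _)).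
- by rewrite lee_fin invr_ge0 exprn_ge0 ?ltW.
Qed.

(** A closed ball of the sup norm, so that its indicator factors over the coordinates; boolean, so
    that [%:R] gives this indicator. *)
Definition cube (c : seq R) (r : R) (s : seq R) : bool :=
  all (fun z => `|z.1 - z.2| <= r)%R (zip c s).

Lemma cubeE c r s : size s = size c ->
  cube c r s = all (fun i => `|nth 0 c i - nth 0 s i| <= r)%R (iota 0 (size c)).
Proof.
move=> ss; apply/(all_nthP (0%R, 0%R))/(all_nthP 0%N) => H i; last first.
  rewrite size1_zip ?ss// nth_zip//= => ic.
  by have := H i; rewrite size_iota nth_iota//; apply.
rewrite size_iota => ic; rewrite nth_iota//.
by have := H i; rewrite size1_zip ?ss// nth_zip//; apply.
Qed.

Lemma cubeP c r s : size s = size c ->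
  reflect (forall i, (i < size c)%N -> `|nth 0 c i - nth 0 s i| <= r)%R
    (cube c r s).
Proof.
move=> ss; rewrite cubeE//; apply: (iffP allP) => H i.
  by move=> ic; apply: H; rewrite mem_iota.
by rewrite mem_iota => /andP[_ ic]; exact: H.
Qed.

Lemma iint_cube k c r : (0 <= r)%R -> size c = k ->
  iint k (fun s => (cube c r s)%:R%:E) = ((2 * r) ^+ k)%:E.
Proof.
move=> r0; elim: k c => [|k IH] [|c0 c]// [sc] /=.
transitivity (\int[mu]_t (((2 * r) ^+ k)%:E * (\1_(`[(c0 - r)%R, (c0 + r)%R]%classic) t)%:E)).
  apply: eq_integral => t _; rewrite indicE.
  have -> : (t \in `[(c0 - r)%R, (c0 + r)%R]%classic) = (`|c0 - t| <= r)%R.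
    by rewrite mem_setE in_itv/= distrC ler_distl.
  rewrite /cube/=; case: (_ <= _)%R => /=.
    by rewrite mule1 -(IH c sc).
  (* Outside the interval the remaining integrand is zero, and so are its iterated integrals. *)
  rewrite mule0; elim: (k) => [//|j IHj] /=.
  by under eq_integral do rewrite IHj; rewrite integral0.
rewrite ge0_integralZl//.
- rewrite integral_indic// setIT/= lebesgue_measure_itv/= lte_fin.
  case: ifPn => [_|].
    by rewrite -EFinB -EFinM; congr EFin; rewrite exprSr; congr (_ * _)%R; ring.
  rewrite -leNgt => cr; have -> : r = 0%R by apply/eqP; rewrite eq_le r0 andbT; lra.
  by rewrite mule0 mulr0 expr0n.
- exact/measurable_EFinP/measurable_indic.
- by rewrite lee_fin exprn_ge0// mulr_ge0.
Qed.

Lemma measurable_nth d (T : measurableType d) k i :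
  measurable_fun [set: T * k.-tuple R] (fun q => nth 0%R q.2 i).
Proof.
have [ik|ki] := ltnP i k.
  rewrite (_ : (fun _ => _) = (fun q => tnth q.2 (Ordinal ik))); last first.
    by apply/funext => q; rewrite (tnth_nth 0%R).
  exact: measurableT_comp (measurable_tnth (Ordinal ik)) measurable_snd.
rewrite (_ : (fun _ => _) = cst 0%R); first exact: measurable_cst.
by apply/funext => q; rewrite nth_default// size_tuple.
Qed.

Lemma measurable_natr_bool d (T : measurableType d) (b : T -> bool) :
  measurable_fun setT b -> measurable_fun setT (fun x => (b x)%:R : R).
Proof.
move=> mb; rewrite (_ : (fun _ => _) = fun x => if b x then 1%R else 0%R).
  by apply: measurable_fun_ifT.
by apply/funext => x; case: (b x).
Qed.

Lemma measurable_cube d (T : measurableType d) k c r : size c = k ->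
  measurable_fun [set: T * k.-tuple R] (fun q => cube c r q.2).
Proof.
move=> sc; rewrite (_ : (fun _ => _) = (fun q : T * k.-tuple R =>
  all (fun i => `|nth 0 c i - nth 0 q.2 i| <= r)%R (iota 0 (size c)))); last first.
  by apply/funext => q; rewrite cubeE// size_tuple.
elim: (iota 0 (size c)) => [|i l IHl] /=; first exact: measurable_cst.
apply: measurable_and => //; apply: measurable_fun_ler; last exact: measurable_cst.
apply: measurableT_comp => //; apply: measurable_funB; first exact: measurable_cst.
exact: measurable_nth.
Qed.

End AffineChange.

(** * Increments along segments *)

Section Paths.
Context {R : realType}.
Notation mu := (@lebesgue_measure R).

Lemma row_ball n (x y : 'rV[R]_n) (e : R) : 0 < e ->
  (forall i, `|x 0 i - y 0 i| < e) -> ball x e y.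
Proof.
move=> e0 H; split => // i j; rewrite (ord1 i) -ball_normE /ball_/=; exact: H.
Qed.

(** The preimage of an open interval under [g] is open, hence a countable union of boxes with
    rational centres and radii 1/(k+1). The preimage of a box under [phi] is a finite intersection
    of measurable sets. *)
Lemma measurable_continuous_row d (T : measurableType d) n (g : 'rV[R]_n -> R)
    (phi : T -> 'rV[R]_n) : continuous g ->
  (forall i, measurable_fun setT (fun x => phi x 0 i)) ->
  measurable_fun setT (fun x => g (phi x)).
Proof.
move=> cg mphi; apply: (measurability _ (RGenOpens.measurableE R)).
move=> _ [_ [a [b ->] <-]]; rewrite setTI.
pose U : set 'rV[R]_n := g @^-1` `]a, b[%classic.
have oU : open U.
  by move/continuousP : cg; apply; exact: interval_open.
pose box (q : 'rV[rat]_n * nat) : set 'rV[R]_n :=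
  [set y | forall i, `|ratr (q.1 0 i) - y 0 i| < q.2.+1%:R^-1].
pose F (q : 'rV[rat]_n * nat) : set T :=
  if `[< box q `<=` U >] then phi @^-1` (box q) else set0.
rewrite (_ : _ @^-1` _ = \bigcup_q F q).
  apply: countable_bigcupT_measurable; first exact: countableP.
  move=> q; rewrite /F; case: ifPn => // _.
  rewrite (_ : _ @^-1` _ = \bigcap_(i in [set: 'I_n])
      [set x | `|ratr (q.1 0 i) - phi x 0 i| < q.2.+1%:R^-1]); last first.
    by apply/seteqP; split => [x H i _|x H i]; exact: H.
  apply: fin_bigcap_measurable; first exact: finite_finset.
  move=> i _.
  have mlt : measurable_fun setT
      (fun x => `|ratr (q.1 0 i) - phi x 0 i| < q.2.+1%:R^-1).
    apply: measurable_fun_ltr; last exact: measurable_cst.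
    by apply: measurableT_comp => //; apply: measurable_funB.
  by rewrite -[X in measurable X]setTI; exact: (mlt measurableT [set true]).
apply/seteqP; split => [x|x [q _]]; last first.
  by rewrite /F; case: ifPn => // /asboolP qU qx; exact: qU.
move=> Ux; have : nbhs (phi x) U by exact: open_nbhs_nbhs.
move=> /nbhs_ballP[e /= e0 eU].
(* A box of radius below e/2 whose centre is that close to [phi x] stays in the ball of radius e, by
   the triangle inequality. *)
have [k ke] : exists k : nat, k.+1%:R^-1 < e / 2.
  have := near_infty_natSinv_lt (PosNum (divr_gt0 e0 (ltr0Sn R 1))).
  by move=> [k _ /(_ k (leqnn k))] ?; exists k.
have k0 : 0 < k.+1%:R^-1 :> R by rewrite invr_gt0.
have /boolp.choice[q qx] : forall i, exists r : rat,
    `|ratr r - phi x 0 i| < k.+1%:R^-1.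
  move=> i.
  have [|r] := @rat_in_itvoo R (phi x 0 i - k.+1%:R^-1) (phi x 0 i + k.+1%:R^-1).
    by rewrite ltrBlDr -addrA ltrDl addr_gt0.
  by rewrite in_itv/= -ltr_distl => ?; exists r.
exists (\row_i q i, k) => //; rewrite /F ifT; last first.
  apply/asboolP => y yq; apply: eU; apply: row_ball => // i.
  have := yq i; have := qx i; rewrite mxE/= => h1 h2.
  rewrite (_ : phi x 0 i - y 0 i = (ratr (q i) - y 0 i) - (ratr (q i) - phi x 0 i)); last by ring.
  by apply: (le_lt_trans (ler_normB _ _)); rewrite (splitr e) ltrD// (lt_trans _ ke).
by move=> i; rewrite mxE; exact: qx.
Qed.

Lemma smooth_differentiable n (u : 'rV[R]_n -> R) x : smooth u -> differentiable u x.
Proof. by move=> /(_ [::]); apply. Qed.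

Lemma smooth_continuous_derive n (u : 'rV[R]_n -> R) v :
  smooth u -> continuous ('D_v u).
Proof.
by move=> su x; apply: differentiable_continuous; exact: (su [:: v]).
Qed.

Lemma grad_norm_ge0 n (u : 'rV[R]_n -> R) z : 0 <= grad_norm u z.
Proof. exact: sqrtr_ge0. Qed.

Lemma ler_partial_grad_norm n (u : 'rV[R]_n -> R) i z :
  `|partial i u z| <= grad_norm u z.
Proof.
rewrite -sqrtr_sqr ler_wsqrtr// (bigD1 i)//= lerDl sumr_ge0// => j _.
exact: sqr_ge0.
Qed.

(** Expand v in the canonical basis and bound every partial derivative by the gradient norm. The
    crude factor n only affects constants. *)
Lemma ler_derive_grad_norm n (u : 'rV[R]_n -> R) (L : R) (v z : 'rV[R]_n) :
  smooth u -> (forall i, `|v 0 i| <= L) ->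
  `|'D_v u z| <= L *+ n * grad_norm u z.
Proof.
move=> su vL; have du := smooth_differentiable z su.
rewrite deriveE// (row_sum_delta v) linear_sum.
apply: (le_trans (ler_norm_sum _ _ _)).
rewrite -mulr_natr mulrAC mulr_natr -[X in _ *+ X]card_ord -sumr_const.
apply: ler_sum => i _; rewrite linearZ normrM; apply: ler_pM => //.
by rewrite -deriveE//; exact: ler_partial_grad_norm.
Qed.

Lemma measurable_grad_norm d (T : measurableType d) n (u : 'rV[R]_n -> R)
    (phi : T -> 'rV[R]_n) : smooth u ->
  (forall i, measurable_fun setT (fun x => phi x 0 i)) ->
  measurable_fun setT (fun x => grad_norm u (phi x)).
Proof.
move=> su mphi; apply: (@measurableT_comp _ _ _ _ _ _ (@Num.sqrt R)).
  by apply: continuous_measurable_fun => y; exact: sqrt_continuous.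
apply: measurable_sum => i; apply: measurable_funX.
by apply: measurable_continuous_row => //; exact: smooth_continuous_derive.
Qed.

(** Fundamental theorem of calculus for t -> u(x + t(z - x)), whose derivative is the derivative of
    u along z - x. *)
Lemma ler_increment_grad n (u : 'rV[R]_n -> R) (L : R) (x z : 'rV[R]_n) :
  smooth u -> (forall i, `|z 0 i - x 0 i| <= L) ->
  (`|u x - u z|%:E <=
   \int[mu]_(t in `]0%R, 1%R[) (L *+ n * grad_norm u (x + t *: (z - x)))%:E)%E.
Proof.
move=> su zL; pose v : 'rV[R]_n := z - x; pose F (t : R) := u (x + t *: v).
pose f (t : R) := 'D_v u (x + t *: v).
have cpath : continuous (fun t : R => x + t *: v).
  by move=> t; apply: cvgD; [exact: cvg_cst|exact: scalel_continuous].
have cf : continuous f.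
  move=> t; apply: (@continuous_comp _ _ _ (fun t : R => x + t *: v) ('D_v u)).
    exact: cpath.
  exact: smooth_continuous_derive.
have dF t : derivable F t 1 /\ 'D_1 F t = f t.
  have : derivable u (x + t *: v) v by exact/diff_derivable/smooth_differentiable.
  rewrite /derivable /f /derive.
  rewrite (_ : (fun h : R => h^-1 *: (u (h *: v + (x + t *: v)) - u (x + t *: v))) =
    (fun h : R => h^-1 *: (F (h *: 1 + t) - F t))) //.
  apply/funext => h; rewrite /F [h *: 1]mulr1; congr (_ *: (u _ - _)).
  by rewrite scalerDl addrCA.
have cF : continuous F.
  move=> t; apply: differentiable_continuous; apply/derivable1_diffP.
  by have [] := dF t.
have mF : measurable_fun setT (fun t : R => (L *+ n * grad_norm u (x + t *: v))%:E).
  apply/measurable_EFinP; apply: measurable_funM; first exact: measurable_cst.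
  apply: measurable_grad_norm => // i.
  under eq_fun do rewrite !mxE.
  by apply: measurable_funD => //; apply: measurable_funM.
have F01 := @continuous_FTC2 R f F 0 1 ltr01.
have {}F01 : (\int[mu]_(t in `[0%R, 1%R]) (f t)%:E = (F 1)%:E - (F 0)%:E)%E.
  apply: F01.
  - exact: continuous_subspaceT.
  - split; first by move=> t _; have [] := dF t.
    + by apply: cvg_at_right_filter; exact: cF.
    + by apply: cvg_at_left_filter; exact: cF.
  - by move=> t _; rewrite derive1E; have [] := dF t.
have mf : measurable_fun setT (EFin \o f).
  by apply/measurable_EFinP; exact: continuous_measurable_fun.
rewrite distrC (_ : u z - u x = F 1 - F 0); last first.
  by rewrite /F scale1r scale0r addr0 /v (addrC x) subrK.
rewrite -abse_EFin EFinB -F01; apply: (le_trans (le_abse_integral _ _ _)) => //.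
  exact: measurable_funTS.
(* Dropping the endpoints leaves only 0 < t < 1, where the later pointwise bounds on the integrand
   hold. *)
rewrite integral_itv_bndoo; last first.
  by apply: measurableT_comp => //; exact: measurable_funTS.
apply: ge0_le_integral => //.
- by apply: measurableT_comp => //; exact: measurable_funTS.
- exact: measurable_funTS.
- move=> t _ /=; rewrite lee_fin; apply: ler_derive_grad_norm => // i.
  by rewrite !mxE.
Qed.

End Paths.

(** * Integrals of powers *)

Section PowerIntegrals.
Context {R : realType}.
Notation mu := (@lebesgue_measure R).

Lemma le_integral_ge0_in (D : set R) (f g : R -> \bar R) :
  (forall x, D x -> 0 <= f x)%E -> (forall x, D x -> f x <= g x)%E ->
  (\int[mu]_(x in D) f x <= \int[mu]_(x in D) g x)%E.
Proof.
move=> f0 fg; rewrite integral_mkcond [leRHS]integral_mkcond; apply: le_integral_ge0 => x.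
  exact: erestrict_ge0.
exact: lee_restrict.
Qed.

(** Whatever the sign of b, a power of a ratio between 1/2 and 2 is harmless; this is how the weight
    is treated as constant on local cones. *)
Lemma powR_le_2_norm (x b : R) : 2^-1 <= x -> x <= 2 -> x `^ b <= 2 `^ `|b|.
Proof.
move=> x1 x2; have x0 : 0 < x by lra.
have [b0|b0] := lerP 0 b.
  by rewrite ger0_norm// ge0_ler_powR ?nnegrE// ltW.
have -> : x `^ b = x^-1 `^ (- b).
  by rewrite -powR_inv1 ?ltW// -powRrM mulN1r opprK.
rewrite ltr0_norm// ge0_ler_powR ?nnegrE ?invr_ge0 ?oppr_ge0 ?(ltW b0) ?(ltW x0)//.
by rewrite -[leRHS]invrK lef_pV2 ?posrE ?invr_gt0.
Qed.

Lemma integral_powR_itvcc (a e : R) : a < 1 -> 0 < e -> e < 1 ->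
  (\int[mu]_(t in `[e, 1%R]) (t `^ (- a))%:E <= ((1 - a)^-1)%:E)%E.
Proof.
move=> a1 e0 e1; have a1' : 0 < 1 - a by rewrite subr_gt0.
have dF (t : R) : 0 < t ->
    is_derive t 1 ((1 - a)^-1 \*: (fun t : R => t `^ (1 - a))) (t `^ (- a)).
  move=> t0; have h := is_derive1_powR (1 - a) t0.
  apply: is_derive_eq; rewrite /GRing.scale/= mulrA mulVf ?gt_eqF// mul1r.
  by congr (_ `^ _); ring.
rewrite (@continuous_FTC2 _ _ ((1 - a)^-1 \*: (fun t : R => t `^ (1 - a))))//.
- rewrite -EFinB lee_fin /GRing.scale/= powR1 -mulrBr ler_piMr ?invr_ge0 ?(ltW a1')//.
  by rewrite gerBl powR_ge0.
- apply: derivable_within_continuous => t; rewrite in_itv/= => /andP[et _].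
  by apply: derivable_powR; rewrite in_itv/= andbT (lt_le_trans e0).
- split.
  + move=> t; rewrite in_itv/= => /andP[et _].
    by have [] := dF t (lt_trans e0 et).
  + apply: cvg_at_right_filter; apply: differentiable_continuous.
    by apply/derivable1_diffP; have [] := dF e e0.
  + apply: cvg_at_left_filter; apply: differentiable_continuous.
    by apply/derivable1_diffP; have [] := dF 1 ltr01.
- move=> t; rewrite in_itv/= => /andP[et _].
  by rewrite derive1E; have [] := dF t (lt_trans e0 et).
Qed.

(** Monotone convergence along the intervals [1/(i+2), 1], on which the bound is uniform; the shift
    by 2 keeps the left endpoint below 1. *)
Lemma integral_powR_itv01 (a : R) : a < 1 ->
  (\int[mu]_(t in `]0%R, 1%R[) (t `^ (- a))%:E <= ((1 - a)^-1)%:E)%E.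
Proof.
move=> a1; pose F (i : nat) : set R := `[i.+2%:R^-1, 1]%classic.
have mf D : measurable_fun D (fun t : R => (t `^ (- a))%:E).
  by apply/measurable_EFinP/measurable_funTS; exact: measurable_powR.
have F0 : (\int[mu]_(t in `]0%R, 1%R[) (t `^ (- a))%:E <=
           \int[mu]_(t in \bigcup_i F i) (t `^ (- a))%:E)%E.
  apply: ge0_subset_integral => //.
  - by apply: bigcupT_measurable => i; exact: measurable_itv.
  - exact: mf.
  - by move=> t _; rewrite lee_fin powR_ge0.
  - move=> t /=; rewrite in_itv/= => /andP[t0 t1].
    have := near_infty_natSinv_lt (PosNum t0).
    move=> [k _ /(_ k.+1 (leqnSn k))/= kt].
    by exists k => //=; rewrite /F/= in_itv/= (ltW t1) andbT ltW.
apply: (le_trans F0).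
have Fcvg : (\int[mu]_(t in F i) (t `^ (- a))%:E @[i --> \oo] -->
             \int[mu]_(t in \bigcup_i F i) (t `^ (- a))%:E)%E.
  apply: ge0_nondecreasing_set_cvg_integral => //.
  - move=> i j ij; rewrite subsetEset => t/=; rewrite /F/= !in_itv/=.
    move=> /andP[it ->]; rewrite andbT (le_trans _ it)//.
    by rewrite lef_pV2 ?posrE// ler_nat.
  - by move=> i; exact: measurable_itv.
  - by move=> i; exact: mf.
  - by move=> i t _; rewrite lee_fin powR_ge0.
rewrite -(cvg_lim _ Fcvg)//; apply: lime_le; first by apply/cvg_ex; eexists; exact: Fcvg.
apply: nearW => i; apply: integral_powR_itvcc => //.
by rewrite invf_lt1// ltr1n.
Qed.

Lemma integral_powR_onem_itv01 (a : R) : a < 1 ->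
  (\int[mu]_(t in `]0%R, 1%R[) ((1 - t) `^ (- a))%:E <= ((1 - a)^-1)%:E)%E.
Proof.
move=> a1; apply: le_trans (integral_powR_itv01 a1).
rewrite integral_mkcond [leRHS]integral_mkcond.
set g := (fun t : R => (t `^ (- a))%:E) \_ `]0, 1[.
rewrite (_ : (_ \_ _) = (fun t => g (1 + (- 1) * t))); last first.
  apply/funext => t; rewrite /g !patchE !mem_setE !in_itv/= mulN1r.
  by rewrite subr_gt0 gtrBl andbC.
rewrite ge0_integral_affine//.
- by rewrite normrN1 invr1 mul1e.
- apply/(measurable_restrictT _ _).1; first exact: measurable_itv.
  by apply/measurable_EFinP/measurable_funTS; exact: measurable_powR.
- by move=> y; apply: erestrict_ge0 => t _; rewrite lee_fin powR_ge0.
Qed.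

(** The two singularities sit at opposite ends: for t >= 1/2 the first factor is bounded, for t <
    1/2 the second one is. *)
Lemma integral_beta_bounded (a b : R) : a < 1 -> b < 1 -> exists2 J : R, 0 < J &
  (\int[mu]_(t in `]0%R, 1%R[) (t `^ (- a) * (1 - t) `^ (- b))%:E <= J%:E)%E.
Proof.
move=> a1 b1; pose c := 2 `^ `|a| + 2 `^ `|b| : R.
have c0 : 0 < c by rewrite addr_gt0// powR_gt0.
exists (c * ((1 - a)^-1 + (1 - b)^-1)).
  by rewrite mulr_gt0// addr_gt0// invr_gt0 subr_gt0.
apply: (@le_trans _ _ (\int[mu]_(t in `]0%R, 1%R[)
    (c%:E * ((t `^ (- a))%:E + ((1 - t) `^ (- b))%:E)))%E).
  apply: le_integral_ge0_in => t /=; rewrite in_itv/= => /andP[t0 t1].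
    by rewrite lee_fin mulr_ge0// powR_ge0.
  rewrite -EFinD -EFinM lee_fin.
  have pa := powR_ge0 t (- a); have pb := powR_ge0 (1 - t) (- b).
  have ca : 2 `^ `|a| >= 0 :> R by exact: powR_ge0.
  have cb : 2 `^ `|b| >= 0 :> R by exact: powR_ge0.
  have [t2|t2] := lerP 2^-1 t.
    have ha : t `^ (- a) <= 2 `^ `|a| by rewrite -normrN powR_le_2_norm//; lra.
    apply: (@le_trans _ _ (2 `^ `|a| * (1 - t) `^ (- b))); first exact: ler_wpM2r.
    by rewrite /c; nra.
  have hb : (1 - t) `^ (- b) <= 2 `^ `|b| by rewrite -normrN powR_le_2_norm//; lra.
  apply: (@le_trans _ _ (t `^ (- a) * 2 `^ `|b|)); first exact: ler_wpM2l.
  by rewrite /c; nra.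
have mp (r : R) D : measurable_fun D (fun t : R => (t `^ (- r))%:E).
  by apply/measurable_EFinP/measurable_funTS; exact: measurable_powR.
have mq (r : R) (D : set R) : measurable_fun D (fun t : R => ((1 - t) `^ (- r))%:E).
  apply/measurable_EFinP/measurable_funTS.
  apply: (@measurableT_comp _ _ _ _ _ _ (fun t : R => t `^ (- r))).
    exact: measurable_powR.
  exact: measurable_funB.
rewrite ge0_integralZl//; last 3 first.
- by apply: emeasurable_funD; [exact: mp|exact: mq].
- by move=> t _; rewrite adde_ge0// lee_fin powR_ge0.
- by rewrite lee_fin ltW.
rewrite EFinM lee_pmul2l// ge0_integralD//.
- by rewrite EFinD leeD// ?integral_powR_itv01// integral_powR_onem_itv01.
- by move=> t _; rewrite lee_fin powR_ge0.
- exact: mp.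
- by move=> t _; rewrite lee_fin powR_ge0.
- exact: mq.
Qed.

End PowerIntegrals.

(** * The cone estimate *)

Section ConeEstimate.
Context {R : realType}.
Notation mu := (@lebesgue_measure R).

(** The energy integrand, extended by zero so that it can be integrated over the whole space. *)
Definition weighted_density m (gamma p : R) (u : 'rV[R]_m.+1 -> R)
    (z : 'rV[R]_m.+1) : R :=
  if 0 < lastc z then grad_norm u z `^ p * lastc z `^ gamma else 0.

Lemma weighted_density_ge0 m gamma p (u : 'rV[R]_m.+1 -> R) z :
  0 <= weighted_density gamma p u z.
Proof. by rewrite /weighted_density; case: ifP => // _; rewrite mulr_ge0 ?powR_ge0. Qed.

Lemma int_halfspaceE m gamma p (u : 'rV[R]_m.+1 -> R) :
  int_halfspace (fun z => (grad_norm u z `^ p * lastc z `^ gamma)%:E) =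
  iint m.+1 (fun s => (weighted_density gamma p u (row_of_seq m.+1 s))%:E).
Proof. by apply: eq_iint => s _; rewrite /weighted_density; case: ifP. Qed.

Lemma measurable_weighted_density d (T : measurableType d) m gamma p
    (u : 'rV[R]_m.+1 -> R) (phi : T -> seq R) : smooth u ->
  (forall i, (i < m.+1)%N -> measurable_fun setT (fun x => nth 0 (phi x) i)) ->
  measurable_fun setT
    (fun x => weighted_density gamma p u (row_of_seq m.+1 (phi x))).
Proof.
move=> su mphi; have mc i : measurable_fun setT (fun x => row_of_seq m.+1 (phi x) 0 i).
  by under eq_fun do rewrite mxE; exact: mphi.
apply: measurable_fun_ifT.
- by apply: measurable_fun_ltr; [exact: measurable_cst|exact: mc].
- apply: measurable_funM.
    apply: (@measurableT_comp _ _ _ _ _ _ (fun y : R => y `^ p)).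
      exact: measurable_powR.
    exact: measurable_grad_norm.
  apply: (@measurableT_comp _ _ _ _ _ _ (fun y : R => y `^ gamma)).
    exact: measurable_powR.
  exact: mc.
- exact: measurable_cst.
Qed.

Definition front m (x : 'rV[R]_m.+1) : seq R := mkseq (fun i => x 0 (inord i)) m.

Lemma size_front m (x : 'rV[R]_m.+1) : size (front x) = m.
Proof. exact: size_mkseq. Qed.

Lemma nth_front m (x : 'rV[R]_m.+1) (i : 'I_m.+1) : (i < m)%N ->
  nth 0 (front x) i = x 0 i.
Proof. by move=> im; rewrite nth_mkseq// inord_val. Qed.

Lemma lastc_row_of_seq m (s : seq R) h : size s = m ->
  lastc (row_of_seq m.+1 (rcons s h)) = h.
Proof. by move=> sm; rewrite /lastc mxE nth_rcons sm ltnn eqxx. Qed.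

(** Along the segments to a horizontal base, the horizontal part is a homothety and the height
    depends on t alone, so the two changes of variables decouple. *)
Lemma row_of_seq_homothety m (x : 'rV[R]_m.+1) (s : seq R) (t h : R) :
  size s = m ->
  x + t *: (row_of_seq m.+1 (rcons s h) - x) =
  row_of_seq m.+1 (rcons (homothety t (front x) s) (lastc x + t * (h - lastc x))).
Proof.
move=> sm; apply/rowP => i; rewrite !mxE !nth_rcons size_homothety ?size_front//.
rewrite sm; have [im|im|im] := ltngtP i m.
- by rewrite nth_homothety ?size_front// nth_front.
- by have := ltn_ord i; rewrite ltnS leqNgt im.
- by rewrite (_ : i = ord_max)//; exact: val_inj.
Qed.

(** Either g <= A, or g = g^p / g^(p-1) is at most g^p / A^(p-1). *)
Lemma ler_add_powR (A g p : R) : 0 < A -> 0 <= g -> 1 < p ->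
  g <= A + A `^ (1 - p) * g `^ p.
Proof.
move=> A0 g0 p1; have [gA|Ag] := leP g A.
  by rewrite (le_trans gA)// lerDl mulr_ge0 ?powR_ge0.
rewrite -(mulr_powRB1 g0) ?(lt_trans ltr01 p1)// -(opprB p 1) powRN.
have A1 : 0 < A `^ (p - 1) by rewrite powR_gt0.
have gp : A `^ (p - 1) <= g `^ (p - 1).
  by rewrite ge0_ler_powR ?nnegrE ?subr_ge0 ?(ltW p1) ?(ltW A0) ?(ltW Ag).
apply: ler_wpDl; first exact: ltW.
by rewrite mulrCA ler_peMr// mulrC ler_pdivlMr// mul1r.
Qed.

Section Cone.
Variables (m : nat) (gamma p : R) (u : 'rV[R]_m.+1 -> R).
Hypotheses (hp : m.+1%:R < p) (su : smooth u).
Variables (x : 'rV[R]_m.+1) (h : R).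

Let height (t : R) := lastc x + t * (h - lastc x).
Let target (s : seq R) := row_of_seq m.+1 (rcons s h).
Let W (s : seq R) : R := weighted_density gamma p u (row_of_seq m.+1 s).
Let W0 s : 0 <= W s. Proof. exact: weighted_density_ge0. Qed.

Let measurable_W_rcons : seq_measurable m (fun y s => (W (rcons s y))%:E).
Proof.
apply/measurable_EFinP; apply: measurable_weighted_density => // i _.
rewrite (_ : (fun _ => _) = (fun q : R * m.-tuple R =>
    if (i < m)%N then nth 0 q.2 i else if i == m then q.1 else 0)); last first.
  by apply/funext => q; rewrite nth_rcons size_tuple.
case: (i < m)%N; first exact: measurable_nth.
case: (i == m); [exact: measurable_fst|exact: measurable_cst].
Qed.

Let measurable_W_height : seq_measurable m (fun t s => (W (rcons s (height t)))%:E).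
Proof.
apply: (@seq_measurable_comp _ _ _ _ _ _ height _ _ measurable_W_rcons).
apply: measurable_funD; first exact: measurable_cst.
by apply: measurable_funM.
Qed.

(** The density in cone coordinates, times the Jacobian t^m of the homothety. The cut-off 0 < t < 1
    is part of the integrand, so that Tonelli applies on the full line. *)
Let Phi (t : R) (s : seq R) : \bar R :=
  ((0 < t < 1)%R%:R * (t ^+ m * W (rcons (homothety t (front x) s) (height t))))%:E.

Let Phi_ge0 t s : (0 <= Phi t s)%E.
Proof.
rewrite /Phi; case: (boolP (_ < _ < _)) => [/andP[t0 _]|_]; last by rewrite mul0r.
by rewrite mul1r lee_fin mulr_ge0// exprn_ge0// ltW.
Qed.

Let measurable_Phi : seq_measurable m Phi.
Proof.
apply/measurable_EFinP; apply: measurable_funM.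
  apply: (@measurable_natr_bool R _ _ (fun q : R * m.-tuple R => 0 < q.1 < 1)).
  by apply: measurable_and; apply: measurable_fun_ltr.
apply: measurable_funM; first exact: measurable_funX.
apply: measurable_weighted_density => // i _.
rewrite (_ : (fun _ => _) = (fun q : R * m.-tuple R =>
    if (i < m)%N then nth 0 (front x) i + q.1 * (nth 0 q.2 i - nth 0 (front x) i)
    else if i == m then height q.1 else 0)); last first.
  apply/funext => q; rewrite nth_rcons size_homothety ?size_front ?size_tuple//.
  by case: ifP => // im; rewrite nth_homothety ?size_front ?size_tuple.
case: (i < m)%N; last (case: (i == m); last exact: measurable_cst).
- apply: measurable_funD; first exact: measurable_cst.
  apply: measurable_funM; first exact: measurable_fst.
  by apply: measurable_funB; [exact: measurable_nth|exact: measurable_cst].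
- apply: measurable_funD; first exact: measurable_cst.
  by apply: measurable_funM; [exact: measurable_fst|exact: measurable_cst].
Qed.

(** For fixed t the factor t^m cancels against the homothety and leaves the slice at height
    [height t]. Substituting y = [height t] then costs 1/|h - x_n|, and the cut-off is dropped by
    positivity. *)
Lemma iint_cone_le : h != lastc x ->
  (iint m (fun s => \int[mu]_t Phi t s) <=
   `|h - lastc x|^-1%:E * iint m.+1 (fun s => (W s)%:E))%E.
Proof.
move=> hx; rewrite -iint_tonelli//.
apply: (@le_trans _ _ (\int[mu]_t iint m (fun s => (W (rcons s (height t)))%:E))%E).
  apply: le_integral_ge0 => t; first by apply: iint_ge0 => s _.
  have [t01|t01] := boolP (0 < t < 1); last first.
    have -> : Phi t = fun=> 0%E.
      by apply/funext => s; rewrite /Phi (negPf t01) mul0r.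
    have -> : iint m (fun=> 0%E) = 0%E :> \bar R.
      by elim: (m) => [//|j IH]/=; under eq_integral do rewrite IH; rewrite integral0.
    by apply: iint_ge0 => s _; rewrite lee_fin.
  have t0 : 0 < t by case/andP: t01.
  rewrite (@eq_iint _ _ _ (fun s => (t ^+ m)%:E *
      (W (rcons (homothety t (front x) s) (height t)))%:E)%E); last first.
    by move=> s _; rewrite /Phi t01 mul1r EFinM.
  have Wh0 (t' : R) s : (0 <= (W (rcons s (height t')))%:E)%E by rewrite lee_fin.
  have mh : seq_measurable m (fun (t' : R) s =>
      (W (rcons (homothety t (front x) s) (height t')))%:E).
    apply/measurable_EFinP; apply: measurable_weighted_density => // i _.
    rewrite (_ : (fun _ => _) = (fun q : R * m.-tuple R =>
      if (i < m)%N then nth 0 (front x) i + t * (nth 0 q.2 i - nth 0 (front x) i)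
      else if i == m then height q.1 else 0)); last first.
      apply/funext => q; rewrite nth_rcons size_homothety ?size_front ?size_tuple//.
      by case: ifP => // im; rewrite nth_homothety ?size_front ?size_tuple.
    case: (i < m)%N; last (case: (i == m); last exact: measurable_cst).
    - apply: measurable_funD; first exact: measurable_cst.
      apply: measurable_funM; first exact: measurable_cst.
      by apply: measurable_funB; [exact: measurable_nth|exact: measurable_cst].
    - apply: measurable_funD; first exact: measurable_cst.
      by apply: measurable_funM; [exact: measurable_fst|exact: measurable_cst].
  have tm0 : 0 <= t ^+ m by rewrite exprn_ge0// ltW.
  have Wh1 (t' : R) s : (0 <= (W (rcons (homothety t (front x) s) (height t')))%:E)%E.
    by rewrite lee_fin.
  rewrite (ge0_iintZl t tm0 Wh1 mh).
  rewrite (iint_homothety _ t0 (size_front x) Wh0 measurable_W_height).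
  by rewrite muleA -EFinM divff ?mul1e// expf_neq0// gt_eqF.
pose K (y : R) := iint m (fun s => (W (rcons s y))%:E).
have Wr0 (y : R) s : (0 <= (W (rcons s y))%:E)%E by rewrite lee_fin.
have mK : measurable_fun setT K := measurable_iint Wr0 measurable_W_rcons.
rewrite iint_rcons -(iint_tonelli Wr0 measurable_W_rcons).
have K0 y : (0 <= K y)%E by apply: iint_ge0 => s _.
have hx0 : h - lastc x != 0 by rewrite subr_eq0.
rewrite -(ge0_integral_affine (lastc x) hx0 mK K0).
by under [in leLHS]eq_integral do rewrite /height mulrC.
Qed.

Let measurable_int_Phi : seq_measurable m (fun (_ : R) s => \int[mu]_t Phi t s)%E.
Proof.
have mPhi : measurable_fun setT
    (fun w : (R * m.-tuple R) * R => Phi w.2 w.1.2).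
  pose g (w : (R * m.-tuple R) * R) : R * m.-tuple R := (w.2, w.1.2).
  suff mg : measurable_fun setT g by exact: measurableT_comp measurable_Phi mg.
  apply/measurable_fun_pairP; split; first exact: measurable_snd.
  exact: (measurableT_comp measurable_snd measurable_fst).
by apply: (measurable_fun_fubini_tonelli_F (m2 := mu) _ mPhi).
Qed.

Let measurable_Phi_section s : size s = m ->
  measurable_fun setT (fun t => Phi t s).
Proof.
move=> sm; pose s' : m.-tuple R := Tuple (introT eqP sm).
suff mg : measurable_fun setT (fun t : R => (t, s')).
  exact: (measurableT_comp measurable_Phi mg).
by apply/measurable_fun_pairP; split; [exact: measurable_id|exact: measurable_cst].
Qed.

(** For positive heights its power 1 - p is t^m (height t / M)^gamma. Normalising by M allows an
    integral bound J independent of scale. *)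
Let kernel (M t : R) :=
  t `^ (- (m%:R / (p - 1))) * (height t / M) `^ (- (gamma / (p - 1))).

Let p1 : 1 < p.
Proof. by apply: le_lt_trans hp; rewrite ler1n. Qed.

(* The threshold A in [g <= A + A^(1-p) g^p] is chosen so that A^(1-p) is, up
   to a constant, the Jacobian t^m of the homothety times the weight. *)
Let kernel_power (d M E t : R) : 0 < d -> 0 < M -> 0 < E -> 0 < t ->
  0 < height t ->
  let q := d `^ (- (m.+1%:R / p)) * M `^ (- (gamma / p)) in
  (E * q * kernel M t) `^ (1 - p) =
  E `^ (1 - p) * q * d ^+ m.+1 * (t ^+ m * height t `^ gamma).
Proof.
move=> d0 M0 E0 t0 ht0 q.
have pN0 : p - 1 != 0 by rewrite gt_eqF// subr_gt0.
have pn0 : p != 0 by rewrite gt_eqF// (lt_trans _ p1).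
have dN0 : d != 0 by rewrite gt_eqF.
have MN0 : M != 0 by rewrite gt_eqF.
(* The power 1 - p returns q itself up to d^(m+1) and M^gamma; the latter undoes the normalisation
   in [kernel]. *)
have qE : q `^ (1 - p) = q * d ^+ m.+1 * M `^ gamma.
  rewrite /q powRM ?powR_ge0// -!powRrM -powR_mulrn ?(ltW d0)//.
  rewrite -mulrA mulrACA -!powRD ?dN0 ?MN0 ?implybT//.
  by congr (_ `^ _ * _ `^ _); field.
have q0 : 0 <= q by rewrite mulr_ge0 ?powR_ge0.
clearbody q.
rewrite /kernel !powRM ?mulr_ge0 ?powR_ge0 ?invr_ge0 ?(ltW E0) ?(ltW ht0) ?(ltW M0)//.
rewrite -(powR_inv1 (ltW M0)) qE -!powRrM -(powR_mulrn _ (ltW t0)).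
rewrite (_ : - (m%:R / (p - 1)) * (1 - p) = m%:R); last by field.
rewrite (_ : - (gamma / (p - 1)) * (1 - p) = gamma); last by field.
rewrite mulN1r powRN; field.
by rewrite gt_eqF// powR_gt0.
Qed.

(** After [ler_add_powR] on each segment, the terms A give J times the cube volume (2d)^m, and the
    terms with g^p give the energy through [iint_cone_le]; these are the summands of 2^m J + 1. The
    case h = 0, a base on the boundary, is allowed. *)
Lemma cone_estimate (c : seq R) (d M E J : R) :
  size c = m -> 0 < d -> 0 < M -> 0 < E -> 0 < lastc x -> 0 <= h ->
  d <= `|h - lastc x| <= 3 * d ->
  (forall s i, size s = m -> cube c d s -> (i < m)%N ->
    `|nth 0 s i - nth 0 (front x) i| <= 3 * d) ->
  (\int[mu]_(t in `]0%R, 1%R[) (kernel M t)%:E <= J%:E)%E ->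
  (iint m.+1 (fun s => (W s)%:E) <= (E `^ p)%:E)%E ->
  (iint m (fun s => ((cube c d s)%:R * `|u x - u (target s)|)%:E) <=
   (3 * m.+1%:R * (2 ^+ m * J + 1) * d ^+ m *
    (d `^ (1 - m.+1%:R / p) * M `^ (- (gamma / p)) * E))%:E)%E.
Proof.
move=> sc d0 M0 E0 x0 h0 /andP[dh hd] cx kJ IE.
set q := d `^ (- (m.+1%:R / p)) * M `^ (- (gamma / p)).
have q0 : 0 < q by rewrite mulr_gt0// powR_gt0.
have dN0 : d != 0 by rewrite gt_eqF.
have EN0 : E != 0 by rewrite gt_eqF.
have dq : d `^ (1 - m.+1%:R / p) * M `^ (- (gamma / p)) = d * q.
  by rewrite powRD ?dN0 ?implybT// [d `^ 1]powRr1 ?(ltW d0)// mulrA.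
(* Even when h = 0 the segment stays inside the open half-space for t < 1. *)
have height_gt0 t : 0 < t < 1 -> 0 < height t.
  by rewrite /height => /andP[t0 t1]; nra.
have kernel_ge0 t : 0 <= kernel M t by rewrite mulr_ge0 ?powR_ge0.
(* 3d bounds every coordinate of [target s - x]; the multiple m+1 comes from
   [ler_increment_grad]. *)
pose K := 3 * d *+ m.+1.
have K0 : 0 <= K by rewrite mulrn_wge0// mulr_ge0// ltW.
pose K2 := K * (E `^ (1 - p) * q * d ^+ m.+1).
have K20 : 0 <= K2.
  by rewrite mulr_ge0// !mulr_ge0 ?powR_ge0 ?exprn_ge0 ?(ltW q0) ?(ltW d0).
have grad_le t s : 0 < t < 1 -> size s = m ->
    ((K * grad_norm u (x + t *: (target s - x)))%:E <=
    (K * (E * q))%:E * (kernel M t)%:E + K2%:E * Phi t s)%E.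
  move=> t01 sm; rewrite /Phi t01 mul1r -!EFinM -EFinD lee_fin.
  have ht := height_gt0 _ t01; have t0 : 0 < t by case/andP: t01.
  rewrite row_of_seq_homothety// /W /weighted_density lastc_row_of_seq; last first.
    by rewrite size_homothety size_front.
  rewrite -/(height t) ht.
  set g := grad_norm u _.
  rewrite (_ : _ + _ = K * (E * q * kernel M t + (E `^ (1 - p) * q * d ^+ m.+1 *
     (t ^+ m * height t `^ gamma)) * g `^ p)); last by rewrite /K2; ring.
  rewrite ler_wpM2l// -kernel_power// ler_add_powR ?grad_norm_ge0//.
  by rewrite !mulr_gt0// powR_gt0// divr_gt0.
have mk : measurable_fun setT (fun t => (kernel M t)%:E).
  have mP (r : R) := @measurable_powR R r.
  apply/measurable_EFinP; apply: measurable_funM; first exact: mP.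
  apply: (measurableT_comp (mP _)).
  apply: measurable_funM; last exact: measurable_cst.
  apply: measurable_funD; first exact: measurable_cst.
  by apply: measurable_funM.
have bound s : size s = m ->
    (((cube c d s)%:R * `|u x - u (target s)|)%:E <=
    (K * (E * q) * J)%:E * ((cube c d s)%:R)%:E + K2%:E * \int[mu]_t Phi t s)%E.
  move=> sm; have I0 : (0 <= K2%:E * \int[mu]_t Phi t s)%E.
    by apply: mule_ge0; [rewrite lee_fin|exact: integral_ge0].
  (* Off the cube the left side is 0. The [Phi] term carries no cut-off to the cube, so it can be
     compared with the whole energy. *)
  case: (boolP (cube c d s)) => cs; last by rewrite mul0r mule0 add0e.
  rewrite mul1r mule1.
  apply: (le_trans (@ler_increment_grad _ _ u (3 * d) x (target s) su _)).
    move=> i; rewrite mxE nth_rcons sm; have [im|im|im] := ltngtP i m.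
    - by rewrite -nth_front//; exact: cx.
    - by have := ltn_ord i; rewrite ltnS leqNgt im.
    - by rewrite (_ : i = ord_max)//; exact: val_inj.
  apply: (@le_trans _ _ (\int[mu]_(t in `]0%R, 1%R[)
      ((K * (E * q))%:E * (kernel M t)%:E + K2%:E * Phi t s))%E).
    apply: le_integral_ge0_in => t /=; rewrite in_itv/= => t01.
      by rewrite lee_fin mulr_ge0 ?grad_norm_ge0.
    exact: grad_le.
  have KE0 : 0 <= K * (E * q) by rewrite (mulr_ge0 K0)// (mulr_ge0 (ltW E0) (ltW q0)).
  have mPhi := measurable_Phi_section sm.
  rewrite ge0_integralD//; last 4 first.
  - by move=> t _; rewrite mule_ge0// lee_fin.
  - by apply: measurable_funTS; apply: measurable_funeM.
  - by move=> t _; rewrite mule_ge0// lee_fin.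
  - by apply: measurable_funTS; apply: measurable_funeM.
  rewrite ge0_integralZl//; last 2 first.
  - exact: measurable_funTS.
  - by move=> t _; rewrite lee_fin.
  rewrite ge0_integralZl//; last exact: measurable_funTS.
  apply: leeD.
    by rewrite [leRHS]EFinM; apply: lee_wpmul2l => //; rewrite lee_fin.
  apply: lee_wpmul2l; first by rewrite lee_fin.
  by apply: ge0_subset_integral.
apply: (@le_trans _ _ (iint m (fun s => (K * (E * q) * J)%:E * ((cube c d s)%:R)%:E +
    K2%:E * \int[mu]_t Phi t s))%E).
  by apply: le_iint bound => s _; rewrite lee_fin mulr_ge0.
have J0 : 0 <= J.
  by rewrite -lee_fin (le_trans _ kJ)// integral_ge0// => t _; rewrite lee_fin.
have mcube : seq_measurable m (fun (_ : R) s => ((cube c d s)%:R)%:E : \bar R).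
  by apply/measurable_EFinP/measurable_natr_bool; exact: measurable_cube.
have KJ0 : 0 <= K * (E * q) * J.
  by rewrite (mulr_ge0 _ J0)// (mulr_ge0 K0)// (mulr_ge0 (ltW E0) (ltW q0)).
rewrite (@ge0_iintD R _ (measurableTypeR R) m
  (fun _ s => (K * (E * q) * J)%:E * ((cube c d s)%:R)%:E)%E
  (fun _ s => K2%:E * \int[mu]_t Phi t s)%E (0 : R)); last 4 first.
- by move=> _ s; apply: mule_ge0; rewrite lee_fin.
- exact: measurable_funeM.
- by move=> _ s; apply: mule_ge0; [rewrite lee_fin|exact: integral_ge0].
- exact: measurable_funeM.
rewrite (ge0_iintZl (0 : R) KJ0 _ mcube); last by move=> _ s; rewrite lee_fin.
rewrite (ge0_iintZl (0 : R) K20 _ measurable_int_Phi); last first.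
  by move=> _ s; rewrite integral_ge0.
rewrite (iint_cube (ltW d0) sc) -EFinM.
have r0 : 0 < `|h - lastc x| by exact: lt_le_trans dh.
(* The factor 1/d comes from d <= |h - x_n|; it turns the d^(m+1) in [K2] into the cube scale
   d^m. *)
apply: (@le_trans _ _ ((K * (E * q) * J * (2 * d) ^+ m)%:E +
    K2%:E * (d^-1%:E * (E `^ p)%:E))%E).
  apply: leeD => //; apply: lee_wpmul2l; first by rewrite lee_fin.
  apply: (le_trans (iint_cone_le _)); first by rewrite -subr_eq0 -normr_gt0.
  apply: lee_pmul => //.
  - by apply: iint_ge0 => s _; rewrite lee_fin.
  - by rewrite lee_fin lef_pV2 ?posrE.
rewrite -!EFinM -EFinD lee_fin dq.
have EE : E `^ (1 - p) * E `^ p = E.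
  by rewrite -powRD ?EN0 ?implybT// subrK powRr1// ltW.
rewrite le_eqVlt; apply/orP; left; apply/eqP.
rewrite /K2 /K -mulr_natl exprMn exprS.
rewrite (_ : m.+1%:R * (3 * d) * (E `^ (1 - p) * q * (d * d ^+ m)) * (d^-1 * E `^ p) =
  m.+1%:R * 3 * q * d * d ^+ m * (d / d) * (E `^ (1 - p) * E `^ p)); last by ring.
by rewrite EE divff ?gt_eqF//; ring.
Qed.

End Cone.

End ConeEstimate.

(** * Weighted Morrey estimates in the half-space *)

Section HalfspaceMorrey.
Context {R : realType}.
Notation mu := (@lebesgue_measure R).

Lemma le0_ler_powR (x y r : R) : r <= 0 -> 0 < x -> x <= y -> y `^ r <= x `^ r.
Proof.
move=> r0 x0 xy; have y0 := lt_le_trans x0 xy.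
rewrite -(opprK r) !(powRN _ (- r)) lef_pV2 ?posrE ?powR_gt0//.
by rewrite ge0_ler_powR ?nnegrE ?oppr_ge0// ltW.
Qed.

Lemma ler_coord_enorm n (v : 'rV[R]_n) i : `|v 0 i| <= enorm v.
Proof.
rewrite -sqrtr_sqr ler_wsqrtr// (bigD1 i)//= lerDl sumr_ge0// => j _.
exact: sqr_ge0.
Qed.

Lemma enorm_ge0 n (v : 'rV[R]_n) : 0 <= enorm v.
Proof. exact: sqrtr_ge0. Qed.

Lemma enorm_le0 n (v : 'rV[R]_n) : enorm v <= 0 -> v = 0.
Proof.
move=> v0; apply/rowP => i; apply/eqP; rewrite mxE -normr_le0.
by apply: le_trans v0; exact: ler_coord_enorm.
Qed.

Lemma enorm_scale_delta n (r : R) (i : 'I_n) : enorm (r *: delta_mx 0 i) = `|r|.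
Proof.
rewrite /enorm (bigD1 i)//= big1 => [|j ji].
  by rewrite !mxE !eqxx mulr1 addr0 sqrtr_sqr.
by rewrite !mxE (negPf ji) andbF mulr0 expr0n.
Qed.

Lemma cube_front m (x : 'rV[R]_m.+1) (r : R) s i : size s = m ->
  cube (front x) r s -> (i < m)%N -> `|nth 0 (front x) i - nth 0 s i| <= r.
Proof.
move=> sm cs im; have sf : size s = size (front x) by rewrite size_front.
by apply: (elimT (@cubeP R (front x) r s sf) cs); rewrite size_front.
Qed.

Section Estimates.
Variables (m : nat) (gamma p : R).
Hypothesis hp : m.+1%:R < p.

Let beta := 1 - m.+1%:R / p.
Let kappa := 1 - (m.+1%:R + gamma) / p.

(** A real E bounds the weighted L^p norm, which keeps all estimates between real numbers; the root
    and an infinite integral are dealt with only in the theorem. *)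
Definition energy_le (u : 'rV[R]_m.+1 -> R) (E : R) : Prop :=
  (iint m.+1 (fun s => (weighted_density gamma p u (row_of_seq m.+1 s))%:E)
    <= (E `^ p)%:E)%E.

Let p1 : 1 < p. Proof. by apply: le_lt_trans hp; rewrite ler1n. Qed.

Let a1 : m%:R / (p - 1) < 1.
Proof. by rewrite ltr_pdivrMr ?subr_gt0// mul1r ltrBrDr natr1. Qed.

Let kappaE : kappa = beta - gamma / p.
Proof. by rewrite /kappa /beta mulrDl opprD addrA. Qed.

(** Averaging: a constant integrates over the cube to itself times (2d)^m. *)
Let cube_lower (c : seq R) (d k B : R) : size c = m -> 0 < d -> 0 <= k ->
  (iint m (fun s => ((cube c d s)%:R * k)%:E) <= (B * d ^+ m)%:E)%E ->
  k <= B / 2 ^+ m.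
Proof.
move=> sc d0 k0; have mcube : seq_measurable m
    (fun (_ : R) s => ((cube c d s)%:R)%:E : \bar R).
  by apply/measurable_EFinP/measurable_natr_bool; exact: measurable_cube.
rewrite (@eq_iint _ _ _ (fun s => k%:E * ((cube c d s)%:R)%:E)%E); last first.
  by move=> s _; rewrite -EFinM mulrC.
rewrite (ge0_iintZl (0 : R) k0 _ mcube); last by move=> _ s; rewrite lee_fin.
rewrite (iint_cube (ltW d0) sc) -EFinM lee_fin exprMn mulrA.
by rewrite ler_pM2r ?exprn_gt0// ler_pdivlMr ?exprn_gt0.
Qed.

(** Both points are compared with one cube, centred above x at height M + 2d; the two cones give the
    factor 2 in the constant. *)
Lemma morrey_local : exists2 C : R, 0 < C &
  forall (u : 'rV[R]_m.+1 -> R) (E : R), smooth u -> 0 < E -> energy_le u E ->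
  forall x y, halfspace x -> halfspace y ->
  enorm (x - y) <= Num.max (lastc x) (lastc y) / 2 ->
  `|u x - u y| <= C * (enorm (x - y) `^ beta *
    Num.max (lastc x) (lastc y) `^ (- (gamma / p)) * E).
Proof.
pose b := gamma / (p - 1).
pose J := 2 `^ `|b| * (1 - m%:R / (p - 1))^-1.
have J0 : 0 <= J by rewrite mulr_ge0 ?powR_ge0 ?invr_ge0 ?subr_ge0 ?(ltW a1).
pose B := 3 * m.+1%:R * (2 ^+ m * J + 1).
have B0 : 0 < B.
  by rewrite mulr_gt0 ?mulr_gt0 ?ltr0n// ltr_wpDl// mulr_ge0// exprn_ge0.
have C0 : 0 < 2 * B / 2 ^+ m by rewrite divr_gt0 ?exprn_gt0// (mulr_gt0 _ B0).
exists (2 * B / 2 ^+ m) => //.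
move=> u E su E0 uE x y Hx Hy; set d := enorm _; set M := Num.max _ _ => dM.
have xM : lastc x <= M by rewrite le_max lexx.
have yM : lastc y <= M by rewrite le_max lexx orbT.
have M0 : 0 < M by exact: lt_le_trans xM.
(* The cone estimate needs d > 0; otherwise x = y. *)
have [d0|d0] := ltP 0 d; last first.
  have /eqP := enorm_le0 d0; rewrite subr_eq0 => /eqP ->.
  rewrite subrr normr0; apply: mulr_ge0; first exact: ltW.
  by rewrite !mulr_ge0 ?powR_ge0// ltW.
have xy i : `|x 0 i - y 0 i| <= d by have := ler_coord_enorm (x - y) i; rewrite !mxE.
(* Both heights lie in [M - d, M], so the vertical gap to the base lies in [2d, 3d]. Since d <= M/2,
   all heights on the cones lie in [M/2, 2M]. *)
pose h := M + 2 * d.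
pose D (z : 'rV[R]_m.+1) s := (cube (front x) d s)%:R * `|u z - u (row_of_seq m.+1 (rcons s h))|.
have zbound z : (z = x \/ z = y) -> (iint m (fun s => (D z s)%:E) <=
    (B * d ^+ m * (d `^ beta * M `^ (- (gamma / p)) * E))%:E)%E.
  move=> zxy.
  have xz i : `|x 0 i - z 0 i| <= d.
    by case: zxy => ->//; rewrite subrr normr0 ltW.
  have zM : M - d <= lastc z <= M.
    have := xy ord_max; rewrite -!/(lastc _) ler_distl => /andP[xy1 xy2].
    have : M = lastc x \/ M = lastc y.
      by rewrite /M; case: (leP (lastc x) (lastc y)); [right|left].
    by move=> [] ME; case: zxy => ->; apply/andP; split => //; lra.
  have [zM1 zM2] := andP zM.
  have z0 : 0 < lastc z by lra.
  have hz : h - lastc z = `|h - lastc z| by rewrite ger0_norm// /h; lra.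
  apply: (cone_estimate hp su (J := J) (size_front x)) => //.
  - by rewrite /h; lra.
  - by rewrite -hz /h; lra.
  - move=> s i sm cs im; have := cube_front sm cs im.
    have im' : (i < m.+1)%N by exact: ltnW.
    rewrite !(@nth_front _ _ _ (Ordinal im'))//= => xs'.
    have := xz (Ordinal im'); move: xs'.
    set X := x _ _; set Z := z _ _ => h1 h2.
    rewrite (_ : nth 0 s i - Z = (X - Z) - (X - nth 0 s i)); last by ring.
    by apply: (le_trans (ler_normB _ _)); lra.
  (* The height ratio lies in [1/2, 2], so the weight costs 2^|b| and only the power of t
     remains. *)
  - apply: (@le_trans _ _ (\int[mu]_(t in `]0%R, 1%R[)
        ((2 `^ `|b|)%:E * (t `^ (- (m%:R / (p - 1))))%:E))%E).
      apply: le_integral_ge0_in => t /=; rewrite in_itv/= => /andP[t0 t1].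
        by rewrite lee_fin mulr_ge0 ?powR_ge0.
      rewrite -EFinM lee_fin mulrC ler_wpM2r ?powR_ge0// -normrN powR_le_2_norm//.
        by rewrite ler_pdivlMr// /h; nra.
      by rewrite ler_pdivrMr// /h; nra.
    rewrite ge0_integralZl//.
    + rewrite /J EFinM; apply: lee_wpmul2l; first by rewrite lee_fin powR_ge0.
      exact: integral_powR_itv01.
    + by apply/measurable_EFinP/measurable_funTS; exact: measurable_powR.
    + by move=> t _; rewrite lee_fin powR_ge0.
have mD z : seq_measurable m (fun (_ : R) s => (D z s)%:E).
  apply/measurable_EFinP; apply: measurable_funM.
    by apply: measurable_natr_bool; exact: measurable_cube (size_front x).
  apply: measurableT_comp => //; apply: measurable_funB; first exact: measurable_cst.
  apply: (@measurable_continuous_row R _ _ _ u).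
    by move=> w; apply: differentiable_continuous; exact: smooth_differentiable.
  move=> i; under eq_fun do rewrite mxE nth_rcons size_tuple.
  case: (i < m)%N; first exact: measurable_nth.
  by case: (nat_of_ord i == m); exact: measurable_cst.
have D0 z s : (0 <= (D z s)%:E)%E by rewrite lee_fin mulr_ge0.
rewrite (_ : 2 * B / 2 ^+ m * _ =
   (2 * B * (d `^ beta * M `^ (- (gamma / p)) * E)) / 2 ^+ m); last by ring.
apply: (@cube_lower (front x) d) => //; first exact: size_front.
apply: (@le_trans _ _ (iint m (fun s => (D x s)%:E + (D y s)%:E))%E).
  apply: le_iint => s _; first by rewrite lee_fin mulr_ge0.
  rewrite -EFinD lee_fin -mulrDr ler_wpM2l// (distrC (u y)).
  rewrite (_ : u x - u y = (u x - u (row_of_seq m.+1 (rcons s h))) +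
    (u (row_of_seq m.+1 (rcons s h)) - u y)); last by ring.
  exact: ler_normD.
rewrite (@ge0_iintD R _ (measurableTypeR R) m (fun _ s => (D x s)%:E)
  (fun _ s => (D y s)%:E) (0 : R))//; last 2 first.
- exact: mD.
- exact: mD.
rewrite (_ : (_ * d ^+ m)%:E =
  (B * d ^+ m * (d `^ beta * M `^ (- (gamma / p)) * E))%:E +
  (B * d ^+ m * (d `^ beta * M `^ (- (gamma / p)) * E))%:E)%E; last first.
  by rewrite -EFinD; congr EFin; ring.
by apply: leeD; apply: zbound; [left|right].
Qed.

(** * Pointwise bounds on u by a power of the height *)

Lemma vanishing_off_halfspace (u : 'rV[R]_m.+1 -> R) z :
  Cc_infty_halfspace u -> ~ halfspace z -> u z = 0.
Proof. by move=> [_ [K [_ [KH u0]]]] Hz; apply: u0 => /KH. Qed.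

Lemma pointwise_bound_ge0 : (0 < m)%N -> 0 <= kappa -> exists2 C : R, 0 < C &
  forall (u : 'rV[R]_m.+1 -> R) (E : R), Cc_infty_halfspace u -> 0 < E ->
  energy_le u E -> forall x, halfspace x -> `|u x| <= C * (lastc x `^ kappa * E).
Proof.
move=> m0 k0; have p0 : 0 < p by rewrite (lt_trans _ p1).
(* From kappa >= 0 one gets gamma <= p - (m+1), and m > 0 makes this strictly less than p - 1. *)
have b1 : gamma / (p - 1) < 1.
  rewrite ltr_pdivrMr ?subr_gt0// mul1r ltrBrDr.
  move: k0; rewrite /kappa subr_ge0 ler_pdivrMr// mul1r; apply: lt_le_trans.
  by rewrite addrC ltrD2r ltr1n.
have [J J0 JE] := integral_beta_bounded a1 b1.
pose B := 3 * m.+1%:R * (2 ^+ m * J + 1).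
have B0 : 0 < B.
  by rewrite mulr_gt0 ?mulr_gt0 ?ltr0n// ltr_wpDl// mulr_ge0 ?exprn_ge0// ltW.
exists (B / 2 ^+ m); first by rewrite (divr_gt0 B0)// exprn_gt0.
move=> u E uC E0 uE x Hx; set X := lastc x; have X0 : 0 < X by [].
rewrite mulrAC; apply: (@cube_lower (front x) X) => //; first exact: size_front.
rewrite (_ : B * (X `^ kappa * E) * X ^+ m =
  B * X ^+ m * (X `^ beta * X `^ (- (gamma / p)) * E)); last first.
  have XN0 : X != 0 by rewrite gt_eqF.
  by rewrite -powRD ?XN0 ?implybT// -kappaE; ring.
(* u vanishes on the boundary, so |u x| is an increment between x and the base of the cone. *)
rewrite (@eq_iint _ _ _ (fun s =>
    ((cube (front x) X s)%:R * `|u x - u (row_of_seq m.+1 (rcons s 0))|)%:E)); last first.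
  move=> s sm; rewrite (@vanishing_off_halfspace u (row_of_seq _ _))// ?subr0//.
  by rewrite /halfspace/= lastc_row_of_seq// ltxx.
have [su _] := uC.
apply: (cone_estimate hp su (size_front x) X0 X0 E0 Hx (lexx 0) _ _ _ uE).
- by rewrite sub0r normrN (gtr0_norm X0); apply/andP; split; lra.
- move=> s i sm cs im; have := cube_front sm cs im.
  by rewrite distrC => h1; apply: (le_trans h1); lra.
(* With h = 0 and M = x_n the height ratio is 1 - t, and [kernel] is a beta integrand. *)
- apply: le_trans JE; rewrite le_eqVlt; apply/orP; left; apply/eqP.
  apply: eq_integral => t _; congr (_ * _ `^ _)%:E.
  by rewrite -/X; field; rewrite gt_eqF.
Qed.

(** Going from height X to 2X covers the distance X, exactly half the larger height, as
    [morrey_local] permits. The error is a multiple of X^kappa E, and doubling X multiplies it by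
    2^kappa < 1. *)
Lemma pointwise_bound_lt0 : kappa < 0 -> exists2 C : R, 0 < C &
  forall (u : 'rV[R]_m.+1 -> R) (E : R), Cc_infty_halfspace u -> 0 < E ->
  energy_le u E -> forall x, halfspace x -> `|u x| <= C * (lastc x `^ kappa * E).
Proof.
move=> k0; have [C1 C10 H] := morrey_local.
pose C2 := C1 * 2 `^ (- (gamma / p)).
have C20 : 0 < C2 by rewrite mulr_gt0 ?powR_gt0.
have k1 : 0 < 1 - 2 `^ kappa :> R.
  rewrite subr_gt0 -(opprK kappa) powRN invf_lt1 ?powR_gt0//.
  have := @gt0_ltr_powR R (- kappa); rewrite oppr_gt0 => /(_ k0 1 2).
  by rewrite powR1; apply; rewrite ?nnegrE// ltr1n.
exists (C2 / (1 - 2 `^ kappa)); first by rewrite divr_gt0.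
move=> u E uC E0 uE x0 Hx0; have su : smooth u by case: uC.
pose up (x : 'rV[R]_m.+1) (k : nat) : 'rV[R]_m.+1 :=
  x + ((2 ^+ k - 1) * lastc x) *: delta_mx 0 ord_max.
have lastc_up x k : lastc (up x k) = 2 ^+ k * lastc x.
  by rewrite /up /lastc !mxE !eqxx mulr1; ring.
have up_step x k : up (up x 1) k = up x k.+1.
  rewrite {1}/up lastc_up /up -addrA -scalerDl; congr (_ + _ *: _).
  by rewrite exprS expr1; ring.
have step x : halfspace x -> `|u x - u (up x 1)| <= C2 * (lastc x `^ kappa * E).
  move=> Hx; have X0 : 0 < lastc x by [].
  have Hup : halfspace (up x 1) by rewrite /halfspace/= lastc_up mulr_gt0.
  have xup : enorm (x - up x 1) = lastc x.
    rewrite /up opprD addrA subrr add0r -scaleNr enorm_scale_delta.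
    by rewrite expr1 normrN ger0_norm; [ring|rewrite mulr_ge0 ?ltW//; lra].
  have Mx : Num.max (lastc x) (lastc (up x 1)) = 2 * lastc x.
    by rewrite lastc_up expr1 max_r//; lra.
  have := H u E su E0 uE x (up x 1) Hx Hup; rewrite xup Mx.
  move=> /(_ _)/le_trans; apply; first by rewrite mulrAC divff ?mul1r.
  rewrite powRM ?(ltW X0)// le_eqVlt; apply/orP; left; apply/eqP.
  have XN0 : lastc x != 0 by rewrite gt_eqF.
  by rewrite kappaE [in RHS]powRD ?XN0 ?implybT// /C2; ring.
(* The constant D = C2 / (1 - 2^kappa) solves C2 + 2^kappa D = D, so the induction closes without
   partial sums. *)
have chain k x : halfspace x ->
    `|u x - u (up x k)| <= C2 / (1 - 2 `^ kappa) * (lastc x `^ kappa * E).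
  elim: k x => [|k IH] x Hx.
    rewrite /up expr0 subrr mul0r scale0r addr0 subrr normr0.
    by rewrite !mulr_ge0 ?powR_ge0 ?invr_ge0// ltW.
  have X0 : 0 < lastc x by [].
  have Hup : halfspace (up x 1) by rewrite /halfspace/= lastc_up mulr_gt0.
  have := IH _ Hup; rewrite up_step lastc_up expr1 powRM ?(ltW X0)// => h2.
  have h1 := step _ Hx.
  rewrite (_ : u x - u (up x k.+1) = (u x - u (up x 1)) +
    (u (up x 1) - u (up x k.+1))); last by ring.
  apply: (le_trans (ler_normD _ _)); apply: (le_trans (lerD h1 h2)).
  rewrite le_eqVlt; apply/orP; left; apply/eqP; field.
  by rewrite gt_eqF.
(* The support is bounded in the sup norm, which dominates the last coordinate; a high enough point
   has left it. *)
have [k uk] : exists k, u (up x0 k) = 0.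
  have [_ [K [cK [_ u0]]]] := uC.
  have := compact_bounded cK.
  rewrite /bounded_set/= => -[B [_ /(_ (B + 1))]].
  rewrite ltrDl ltr01 => /(_ isT) KB.
  have [k kB] : exists k : nat, (B + 1) / lastc x0 < 2 ^+ k.
    pose j := (Num.truncn `|(B + 1) / lastc x0|).+1.
    exists j; apply: (le_lt_trans (ler_norm _)).
    apply: (@lt_trans _ _ j%:R); first exact: truncnS_gt.
    by rewrite -natrX ltr_nat ltn_expl.
  exists k; apply: u0 => /KB; apply/negP; rewrite -ltNge.
  apply: (@lt_le_trans _ _ `|lastc (up x0 k)|).
    rewrite lastc_up; apply: (lt_le_trans _ (ler_norm _)).
    by rewrite -ltr_pdivrMr.
  rewrite [leRHS](_ : _ = mx_norm (up x0 k))// mx_normrE; apply/bigmax_geP; right.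
  by exists (0, ord_max).
by have := chain k _ Hx0; rewrite uk subr0.
Qed.

Lemma pointwise_bound : (0 < m)%N -> exists2 C : R, 0 < C &
  forall (u : 'rV[R]_m.+1 -> R) (E : R), Cc_infty_halfspace u -> 0 < E ->
  energy_le u E -> forall x, halfspace x -> `|u x| <= C * (lastc x `^ kappa * E).
Proof.
move=> m0; have [k0|k0] := leP 0 kappa; first exact: pointwise_bound_ge0.
exact: pointwise_bound_lt0.
Qed.

(** Treats both signs of kappa at once: S is the power kappa of the larger height if kappa >= 0, of
    the smaller one if kappa < 0, hence dominates the power at either height. *)
Lemma Theta0_lower (x y : 'rV[R]_m.+1) : halfspace x -> halfspace y ->
  let M := Num.max (lastc x) (lastc y) in
  exists2 S : R, Theta0 beta kappa x y =
      S * (enorm (x - y) `^ beta / Num.max M (enorm (x - y)) `^ beta) &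
    [/\ lastc x `^ kappa <= S, lastc y `^ kappa <= S & M `^ kappa <= S].
Proof.
move=> Hx Hy M; have x0 : 0 < lastc x by []. have y0 : 0 < lastc y by [].
have xM : lastc x <= M by rewrite le_max lexx.
have yM : lastc y <= M by rewrite le_max lexx orbT.
rewrite /Theta0 -/M; case: ifPn => [k0|]; last first.
  rewrite -leNgt => k0; exists (M `^ kappa); first by rewrite mulrA.
  have M0 := lt_le_trans x0 xM.
  by split=> //; rewrite ge0_ler_powR ?nnegrE// ltW.
have m0 : 0 < Num.min (lastc x) (lastc y) by rewrite lt_min x0.
exists (Num.min (lastc x) (lastc y) `^ kappa).
  by rewrite powRN invfM invrK; ring.
by split; rewrite le0_ler_powR ?(ltW k0)// ?ge_min ?lexx ?orbT// xM.
Qed.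

Lemma morrey_Theta0 : (0 < m)%N -> exists2 C : R, 0 < C &
  forall (u : 'rV[R]_m.+1 -> R) (E : R), Cc_infty_halfspace u -> 0 < E ->
  energy_le u E -> forall x y, halfspace x -> halfspace y ->
  `|u x - u y| <= C * Theta0 beta kappa x y * E.
Proof.
move=> m0; have [C1 C10 H1] := morrey_local; have [C2 C20 H2] := pointwise_bound m0.
have p0 : 0 < p by rewrite (lt_trans _ p1).
have beta0 : 0 < beta by rewrite subr_gt0 ltr_pdivrMr// mul1r.
pose C3 := 2 * C2 * 2 `^ beta.
have C30 : 0 < C3 by rewrite mulr_gt0 ?powR_gt0// mulr_gt0.
exists (C1 + C3); first exact: addr_gt0.
move=> u E uC E0 uE x y Hx Hy; have su : smooth u by case: uC.
have [S ->] := Theta0_lower Hx Hy.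
set d := enorm _; set M := Num.max (lastc x) (lastc y) => -[xS yS MS].
have x0 : 0 < lastc x by [].
have M0 : 0 < M by rewrite lt_max x0.
have S0 : 0 < S by apply: lt_le_trans xS; rewrite powR_gt0.
have d0 : 0 <= d by exact: enorm_ge0.
set Q := d `^ beta / _.
have Q0 : 0 <= Q by rewrite divr_ge0 ?powR_ge0.
have SQE : 0 <= S * Q * E by rewrite (mulr_ge0 (mulr_ge0 (ltW S0) Q0))// ltW.
rewrite -mulrA mulrDl; have [dM|Md] := leP d (M / 2).
  apply: ler_wpDr; first by rewrite mulr_ge0// ltW.
  apply: (le_trans (H1 u E su E0 uE x y Hx Hy dM)); rewrite ler_wpM2l ?(ltW C10)//.
  rewrite ler_wpM2r ?(ltW E0)// -/M -/d.
  have -> : Q = d `^ beta / M `^ beta by rewrite /Q max_l//; lra.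
  have MN0 : M != 0 by rewrite gt_eqF.
  (* As kappa = beta - gamma/p, the local bound becomes M^kappa (d/M)^beta, and M^kappa <= S. *)
  have -> : M `^ (- (gamma / p)) = M `^ kappa / M `^ beta.
    rewrite -powRB ?MN0 ?implybT//; congr (_ `^ _).
    by rewrite kappaE; ring.
  by rewrite mulrCA ler_wpM2r// divr_ge0 ?powR_ge0.
apply: ler_wpDl; first by rewrite mulr_ge0// ltW.
have dpos : 0 < d by lra.
(* Here d > M/2 gives max(M, d) <= 2d, so Q is bounded below and the two pointwise bounds
   suffice. *)
have Q2 : (2 `^ beta)^-1 <= Q.
  have MX0 : 0 < Num.max M d by rewrite lt_max M0.
  rewrite ler_pdivlMr ?powR_gt0// mulrC ler_pdivrMr ?powR_gt0// -powRM//.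
  rewrite ge0_ler_powR ?nnegrE ?mulr_ge0 ?(ltW beta0) ?(ltW MX0)//.
  by rewrite ge_max; apply/andP; split; lra.
apply: (le_trans (ler_normB _ _)).
apply: (le_trans (lerD (H2 u E uC E0 uE x Hx) (H2 u E uC E0 uE y Hy))).
apply: (@le_trans _ _ (2 * C2 * (S * E))).
  rewrite -mulrDr -mulrDl (_ : 2 * C2 * (S * E) = C2 * ((S + S) * E)); last by ring.
  by rewrite ler_wpM2l ?(ltW C20)// ler_wpM2r ?(ltW E0)// lerD.
rewrite (_ : C3 * (S * Q * E) = 2 * C2 * ((2 `^ beta * Q) * (S * E))); last first.
  by rewrite /C3; ring.
rewrite ler_wpM2l ?mulr_ge0 ?(ltW C20)// ler_peMl ?mulr_ge0 ?(ltW S0) ?(ltW E0)//.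
by rewrite mulrC -ler_pdivrMr ?powR_gt0// mul1r.
Qed.

End Estimates.

End HalfspaceMorrey.


(* dimension is n.+2, i.e. an arbitrary dimension >= 2 *)
Theorem theorem1p4 (R : realType) (n : nat) (gamma p : R)
  (hp : (n.+2)%:R < p) :
  exists C : R, 0 < C /\
    forall (u : 'rV[R]_n.+2 -> R), Cc_infty_halfspace u ->
    forall x y : 'rV[R]_n.+2, halfspace x -> halfspace y ->
      ((`| u x - u y |)%:E <=
        (C * Theta0 (1 - (n.+2)%:R / p) (1 - ((n.+2)%:R + gamma) / p) x y)%:E
        * (int_halfspace (fun z => ((grad_norm u z) `^ p * (lastc z) `^ gamma)%:E)
             `^ p^-1)%E)%E.
Proof.
have p0 : 0 < p by apply: le_lt_trans hp.
have pN0 : p != 0 by rewrite gt_eqF.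
have [C C0 H] := morrey_Theta0 gamma hp isT.
exists C; split=> // u uC x y Hx Hy; rewrite int_halfspaceE.
set I := iint _ _; set T := Theta0 _ _ x y in H *.
have I0 : (0 <= I)%E.
  by apply: iint_ge0 => s _; rewrite lee_fin weighted_density_ge0.
have H' (E : R) : 0 < E -> (I <= (E `^ p)%:E)%E -> `|u x - u y| <= C * T * E.
  by move=> E0 IE; exact: H.
have T0 : 0 <= C * T.
  apply: mulr_ge0; first exact: ltW.
  by rewrite /T /Theta0; case: ifP => _; rewrite divr_ge0 ?mulr_ge0 ?powR_ge0.
move: I0 H'; case: I => [r| |]//; rewrite ?lee_fin => r0 H'.
  (* The bound requires E > 0 while the energy may vanish, so the norm is enlarged by e/(C T + 1),
     which adds at most e to the right side. *)
  apply/ler_addgt0Pr => e e0.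
  have q0 : 0 <= r `^ p^-1 by exact: powR_ge0.
  have T1 : 0 < C * T + 1 by rewrite ltr_wpDl.
  have E0 : 0 < r `^ p^-1 + e / (C * T + 1) by rewrite ltr_wpDl// divr_gt0.
  apply: (le_trans (H' _ E0 _)).
    have rE : r = (r `^ p^-1) `^ p by rewrite -powRrM mulVf// powRr1.
    rewrite lee_fin [leLHS]rE.
    by rewrite ge0_ler_powR ?nnegrE ?(ltW p0) ?(ltW E0)// lerDl divr_ge0// ltW.
  rewrite mulrDr lerD2l mulrCA ler_piMr ?(ltW e0)// ler_pdivrMr// mul1r.
  by rewrite lerDl.
(* Infinite energy: the right side is infinite as soon as C T > 0. The case x = y is separate
   because 0 times infinity is 0. *)
have [xy|xy] := eqVneq x y.
  by rewrite xy subrr normr0 mule_ge0 ?lee_fin ?poweR_ge0.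
have d0 : 0 < enorm (x - y).
  rewrite ltNge; apply/negP => /enorm_le0/eqP; rewrite subr_eq0 => /eqP yx.
  by rewrite yx eqxx in xy.
have T1 : 0 < C * T.
  have x0 : 0 < lastc x by [].
  have y0 : 0 < lastc y by [].
  apply: mulr_gt0 => //; rewrite /T /Theta0; case: ifP => _.
    by rewrite divr_gt0 ?mulr_gt0 ?powR_gt0 ?lt_max ?lt_min ?x0.
  by rewrite divr_gt0 ?mulr_gt0 ?powR_gt0 ?lt_max ?x0.
by rewrite poweRyr ?invr_eq0// gt0_muley ?lte_fin// leey.
Qed.
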